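(* Let $K=K_1K_2=d\,m\,K_2$ with $K_1,K_2,d,m\in\mathbb{N}^+$, and let $\Sigma$ be a $d\times d$ covariance matrix. Let $X_1,\dots,X_K$ be random variables such that the blocks $(X_{(j-1)d+1},\dots,X_{jd})$, $j=1,\dots,mK_2$, are i.i.d. $N(0,\Sigma)$. Define $Y_i=\sum_{j=1}^{K_1}X_{j+(i-1)K_1}$ for $i=1,\dots,K_2$. Then $$\mathbb{E}\left[\frac{1}{\log K_1}\left(\frac{1}{K_2}\sum_{i=1}^{K_2}\log|Y_i|-\frac1K\sum_{i=1}^K\log|X_i|\right)\right]=\frac12\cdot\frac{\log m+\log\mathbf{1}^\top\Sigma\mathbf{1}-\frac1d\sum_{i=1}^d\log\Sigma_{ii}}{\log m+\log d}.$$ In particular, when $d=K_1\ge2$, $m=1$ and $\Sigma=\beta\mathbf{1}\mathbf{1}^\top+(1-\beta)I$ with $\beta\in[0,1]$, this expectation equals $\frac12\frac{\log(\beta d^2+(1-\beta)d)}{\log d}$, and $$\Big\{\tfrac12\tfrac{\log(\beta d^2+(1-\beta)d)}{\log d}:\beta\in[0,1]\Big\}=\Big[\tfrac12,1\Big].$$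
   Context: $\mathbf{1}\in\mathbb{R}^d$ is the all-ones vector and $I$ the $d\times d$ identity. *)

(* Defs.v *)
From HB Require Import structures.
From mathcomp Require Import all_boot all_order all_algebra.
From mathcomp Require Import all_classical all_reals all_analysis.
From mathcomp Require Import normal_distribution.
Set Implicit Arguments. Unset Strict Implicit. Unset Printing Implicit Defensive.
Import Order.TTheory GRing.Theory Num.Theory.
Local Open Scope classical_set_scope.
Local Open Scope ring_scope.

Section Defs.
Context {R : realType} {dT : measure_display} {T : measurableType dT}.
Variable P : probability T R.

Definition centered_gauss_law (v : R) : set R -> \bar R :=
  if v == 0 then \d_(0 : R) else normal_prob 0 (Num.sqrt v).

(** A random vector (V_0,...,V_{d-1}) is N(0,S) (S a covariance matrix, possibly
    singular): every coordinate is measurable and every linear combination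
    u.V has law N(0, u S u^T) (Cramer-Wold definition of the multivariate normal). *)
Definition centered_gaussian_vector (d : nat) (V : 'I_d -> T -> R) (S : 'M[R]_d) :=
  (forall k, measurable_fun setT (V k)) /\
  forall (u : 'rV[R]_d) (A : set R), measurable A ->
    P ((fun w => \sum_(k < d) u 0 k * V k w) @^-1` A)
    = centered_gauss_law ((u *m S *m u^T) 0 0) A.

(** Mutual independence of the random vectors B_0, ..., B_{n-1}
    (B_j = (B j 0, ..., B j (d-1))): product rule on the generating
    pi-systems of the sigma-algebras sigma(B_j) (taking A j k = setT for
    unused blocks recovers the rule for every subfamily). *)
Definition mutually_independent_vectors (n d : nat) (B : 'I_n -> 'I_d -> T -> R) :=
  forall A : 'I_n -> 'I_d -> set R, (forall j k, measurable (A j k)) ->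
    P (\bigcap_(j in [set: 'I_n]) \bigcap_(k in [set: 'I_d]) (B j k @^-1` A j k))
    = (\prod_(j < n) P (\bigcap_(k in [set: 'I_d]) (B j k @^-1` A j k)))%E.

End Defs.

Definition covariance_matrix {R : realType} (d : nat) (S : 'M[R]_d) :=
  S^T = S /\ forall u : 'rV[R]_d, 0 <= (u *m S *m u^T) 0 0.

Definition ones_quad {R : realType} (d : nat) (S : 'M[R]_d) : R :=
  ((const_mx 1 : 'rV[R]_d) *m S *m (const_mx 1 : 'rV[R]_d)^T) 0 0.

Definition scaling_stat {R : realType} {T : Type} (K1 K2 : nat)
    (X : nat -> T -> R) (w : T) : R :=
  let K := (K1 * K2)%N in
  let Y := fun i : nat => \sum_(j < K1) X (j + i * K1)%N w in
  (ln (K1%:R : R))^-1 *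
    ((K2%:R)^-1 * \sum_(i < K2) ln `|Y i| - (K%:R)^-1 * \sum_(i < K) ln `|X i w|).

(* Main.v *)
(** If V has law N(0, v) with v > 0, then V = sqrt v * Z in law with Z standard
    normal, so E (ln |V|) = (ln v) / 2 + E (ln |Z|).  Each Y_i is a sum of m
    independent block sums of law N(0, 1^T Sigma 1), hence has law
    N(0, m 1^T Sigma 1), and the universal constant E (ln |Z|) cancels between
    the two averages of the statistic. *)

(* [Sigma] may be singular, as it is for [beta = 1], so a block need not have a joint density. Only
   one-dimensional projections are used, onto the coordinates and onto the all-ones vector;
   positivity of their variances puts each of them in the non-Dirac branch of [centered_gauss_law].
   Independence is given on boxes only, so it must be extended to the generated sigma-algebras
   before it says anything about block sums. Adding independent normals is then a convolution of
   densities. Cancelling E ln |Z| requires this number to be finite: ln |x| is unbounded both at 0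
   and at infinity, and the two ends need different dominating functions. *)
Require Import Defs.
From HB Require Import structures.
From mathcomp Require Import all_boot all_order all_algebra.
From mathcomp Require Import all_classical all_reals all_analysis.
From mathcomp Require Import normal_distribution.
From mathcomp Require Import measurable_realfun ring lra zify.
Import Order.TTheory GRing.Theory Num.Theory.
Import numFieldNormedType.Exports.
Local Open Scope classical_set_scope.
Local Open Scope ring_scope.

(** * Affine changes of variables and normal laws *)

(* A [pushforward] is a measure only relative to a proof of measurability, which
   type inference cannot supply; this makes it an explicit argument. *)
Definition image_measure {d1 d2 : measure_display} {T1 : measurableType d1}
    {T2 : measurableType d2} {R : realType} (mu : {measure set T1 -> \bar R})
    (phi : T1 -> T2) (mphi : measurable_fun setT phi) :
    {measure set T2 -> \bar R} :=
  measure_function_pushforward__canonical__measure_function_Measure mu mphi.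

Lemma measurable_affine {R : realType} (a b : R) :
  measurable_fun setT (fun x : R => a * x + b).
Proof. by apply: measurable_funD => //; exact: measurable_funM. Qed.

(** As a function of [A], the right side is a scaled pushforward measure. It has the right value on
    half-open intervals, and these determine Lebesgue measure. *)
Lemma lebesgue_measure_affine {R : realType} (a b : R) (A : set R) :
  0 < a -> measurable A ->
  lebesgue_measure A =
  (a%:E * lebesgue_measure ((fun x : R => (a * x + b)%R) @^-1` A))%E.
Proof.
move=> a0 mA.
have a0' : 0 <= a by exact: ltW.
pose F : measurableTypeR R -> measurableTypeR R := fun x => a * x + b.
have mF : measurable_fun setT F by exact: measurable_affine.
apply: (@lebesgue_measure_unique _
  (mscale (NngNum a0') (image_measure lebesgue_measure _ mF))) => //.
move=> _ [[u v]] _ <-.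
rewrite -[RHS]/(a%:E * lebesgue_measure (F @^-1` `]u, v]))%E.
have -> : F @^-1` `]u, v] = `](u - b) / a, (v - b) / a]%classic.
  apply/seteqP; split => x /=; rewrite !in_itv/= /F ltr_pdivrMr// ler_pdivlMr//;
  by rewrite ltrBlDr lerBrDr mulrC.
rewrite !lebesgue_measure_itv/= !lte_fin ltr_pM2r ?invr_gt0// ltrD2r.
case: ifP => _; last by rewrite mule0.
by rewrite -!EFinB -EFinM; congr EFin; field; exact: lt0r_neq0.
Qed.

Lemma ge0_integral_affine {R : realType} (a b : R) (f : R -> \bar R) :
  0 < a -> measurable_fun setT f -> (forall x, 0 <= f x)%E ->
  (\int[lebesgue_measure]_x f x =
   a%:E * \int[lebesgue_measure]_x f (a * x + b)%R)%E.
Proof.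
move=> a0 mf f0.
have a0' : 0 <= a by exact: ltW.
pose F : measurableTypeR R -> measurableTypeR R := fun x => a * x + b.
have mF : measurable_fun setT F by exact: measurable_affine.
transitivity (\int[mscale (NngNum a0') (image_measure lebesgue_measure _ mF)]_x f x)%E.
  by apply: eq_measure_integral => A mA _; exact: (lebesgue_measure_affine a b).
by rewrite ge0_integral_mscale//= (ge0_integral_pushforward mF).
Qed.

(** * Integration against a measure given by a density *)

Section density.
Context {d : measure_display} {T : measurableType d} {R : realType}.
Variables (mu nu : {measure set T -> \bar R}) (g : T -> R).
Hypotheses (mg : measurable_fun setT g) (g0 : forall x, 0 <= g x).
Hypothesis nuE : forall A, measurable A -> nu A = (\int[mu]_(x in A) (g x)%:E)%E.

Import HBNNSimple.

Let ge0_integral_density_nnsfun (h : {nnsfun T >-> R}) :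
  (\int[nu]_x (h x)%:E = \int[mu]_x ((h x)%:E * (g x)%:E))%E.
Proof.
under eq_integral do rewrite fimfunE -fsumEFin//.
rewrite ge0_integral_fsum//; last 2 first.
- by move=> r; exact/measurable_EFinP/measurable_funM.
- by move=> r x _; rewrite nnfun_muleindic_ge0.
under [RHS]eq_integral => x _.
  rewrite fimfunE -fsumEFin// ge0_mule_fsuml; last first.
    by move=> r; rewrite nnfun_muleindic_ge0.
  over.
rewrite ge0_integral_fsum//; last 2 first.
- move=> r; apply: emeasurable_funM; last exact/measurable_EFinP.
  exact/measurable_EFinP/measurable_funM.
- by move=> r x _; rewrite mule_ge0 ?nnfun_muleindic_ge0// lee_fin.
apply: eq_fsbigr => r _.
have mhr : measurable (h @^-1` [set r]) by [].
have [r0|r0] := ltP r 0.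
  rewrite preimage_nnfun0// !integral0_eq// => x _.
    by rewrite indic0 mulr0 mul0e.
  by rewrite indic0 mulr0.
rewrite integralZl_indic_nnsfun// integral_indic// setIT nuE//.
under [RHS]eq_integral => x _ do rewrite EFinM -muleA.
rewrite ge0_integralZl//; last 2 first.
- by apply: emeasurable_funM; exact/measurable_EFinP.
- by move=> x _; rewrite mule_ge0// lee_fin.
congr (_ * _)%E; rewrite integral_mkcond; apply: eq_integral => x _.
rewrite patchE indicE; case: ifPn => _; first by rewrite mul1e.
by rewrite mul0e.
Qed.

(** Monotone convergence along simple approximations of [f] reduces the claim to simple functions,
    where it is the hypothesis [nuE] on level sets. *)
Lemma ge0_integral_density (f : T -> \bar R) :
  measurable_fun setT f -> (forall x, 0 <= f x)%E ->
  (\int[nu]_x f x = \int[mu]_x (f x * (g x)%:E))%E.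
Proof.
move=> mf f0; pose f_ := nnsfun_approx measurableT mf.
transitivity (limn (fun n => \int[nu]_x (f_ n x)%:E)%E).
  rewrite -monotone_convergence//.
  - apply: eq_integral => y _; apply/esym/cvg_lim => //.
    by apply: cvg_nnsfun_approx.
  - by move=> n; exact/measurable_EFinP/measurable_funP.
  - by move=> n y _; rewrite lee_fin.
  - by move=> y _ m n mn; rewrite lee_fin; exact/lefP/nd_nnsfun_approx.
under eq_fun do rewrite ge0_integral_density_nnsfun.
rewrite -monotone_convergence//.
- apply: eq_integral => y _; apply/cvg_lim => //.
  apply: cvgeZr => //; apply: cvg_nnsfun_approx => //.
- by move=> n; apply: emeasurable_funM; exact/measurable_EFinP.
- by move=> n y _; rewrite mule_ge0// lee_fin.
- move=> y _ m n mn; apply: lee_pmul => //; rewrite ?lee_fin//.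
  exact/lefP/nd_nnsfun_approx.
Qed.

End density.

(** The factor [a] is the Jacobian of the change of variables: it is absorbed by the peak, while the
    exponent is invariant. *)
Lemma normal_pdf_affine {R : realType} (m t a b x : R) : 0 < a -> t != 0 ->
  normal_pdf m t x = a * normal_pdf (a * m + b) (a * t) (a * x + b).
Proof.
move=> a0 t0; have a0' : a != 0 by exact: lt0r_neq0.
rewrite !normal_pdfE ?mulf_neq0// /normal_peak /normal_fun mulrA; congr (_ * _).
  have -> : (a * t) ^+ 2 * pi *+ 2 = a ^+ 2 * (t ^+ 2 * pi *+ 2) by ring.
  by rewrite [in RHS]sqrtrM ?sqr_ge0// sqrtr_sqr gtr0_norm// invfM mulVKf.
congr expR.
have -> : a * x + b - (a * m + b) = a * (x - m) by ring.
by field; rewrite t0.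
Qed.

Lemma normal_prob_affine {R : realType} (m t a b : R) (A : set R) :
  0 < a -> t != 0 -> measurable A ->
  normal_prob m t ((fun x => a * x + b) @^-1` A)
  = normal_prob (a * m + b) (a * t) A.
Proof.
move=> a0 t0 mA; rewrite /normal_prob integral_mkcond [RHS]integral_mkcond.
have mf : measurable_fun setT
    ((fun x : R => (normal_pdf (a * m + b) (a * t) x)%:E) \_ A).
  apply: (measurable_restrictT _ mA).1; apply: measurable_funTS.
  by apply/measurable_EFinP; exact: measurable_normal_pdf.
rewrite (ge0_integral_affine _ b _ a0 mf); last first.
  by move=> x; rewrite patchE; case: ifP => // _; rewrite lee_fin normal_pdf_ge0.
rewrite -ge0_integralZl//; last 3 first.
- by apply: (measurableT_comp mf); exact: measurable_affine.
- by move=> x _; rewrite patchE; case: ifP => // _; rewrite lee_fin normal_pdf_ge0.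
- by rewrite lee_fin ltW.
apply: eq_integral => x _; rewrite !patchE.
have -> : (x \in (fun x => a * x + b) @^-1` A) = (a * x + b \in A).
  by apply/idP/idP; rewrite !inE.
by case: ifP => _; rewrite ?mule0// -EFinM -normal_pdf_affine.
Qed.

(* Completing the square in x, so that integrating out x leaves N(0, s^2 + t^2). *)
Lemma normal_pdf_mul {R : realType} (s t x z : R) : 0 < s -> 0 < t ->
  let r := Num.sqrt (s ^+ 2 + t ^+ 2) in
  normal_pdf 0 s x * normal_pdf x t z
  = normal_pdf 0 r z * normal_pdf (z * s ^+ 2 / (s ^+ 2 + t ^+ 2)) (s * t / r) x.
Proof.
move=> s0 t0 r.
have q0 : 0 < s ^+ 2 + t ^+ 2 by rewrite addr_gt0// exprn_gt0.
have r0 : 0 < r by rewrite sqrtr_gt0.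
have r2 : r ^+ 2 = s ^+ 2 + t ^+ 2 by rewrite sqr_sqrtr// ltW.
have [s0' t0' r0'] : [/\ s != 0, t != 0 & r != 0] by rewrite !lt0r_neq0.
rewrite !normal_pdfE ?mulf_neq0 ?invr_eq0//.
rewrite /normal_peak /normal_fun mulrACA [RHS]mulrACA; congr (_ * _).
  rewrite -!invfM -!sqrtrM; last 2 first.
  - by rewrite mulrn_wge0// mulr_ge0 ?sqr_ge0// pi_ge0.
  - by rewrite mulrn_wge0// mulr_ge0 ?sqr_ge0// pi_ge0.
  congr (_ (Num.sqrt _)); rewrite exprMn exprVn r2 exprMn; field.
  exact: lt0r_neq0.
rewrite -!expRD; congr expR; rewrite exprMn exprVn r2 exprMn; field.
by rewrite !lt0r_neq0.
Qed.

Lemma measurable_normal_pdf2 {R : realType} (t : R) :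
  measurable_fun setT (fun xz : R * R => normal_pdf xz.1 t xz.2).
Proof.
(* For [t != 0] the density depends on z - x only. For [t = 0] it is by convention the indicator of
   [0, 1], hence the case split. *)
have -> : (fun xz : R * R => normal_pdf xz.1 t xz.2) =
    (if t == 0 then \1_`[0, 1] \o snd
     else normal_pdf 0 t \o (fun xz : R * R => xz.2 - xz.1)).
  apply/funext => -[x z]; rewrite /normal_pdf /normal_fun/=.
  by case: eqP => //= _; rewrite subr0.
case: ifP => _.
  by apply: measurableT_comp => //; exact: measurable_indic.
apply: measurableT_comp; first exact: measurable_normal_pdf.
by apply: measurable_funB; [exact: measurable_snd|exact: measurable_fst].
Qed.

(** The convolution of two centered normals in disintegrated form: given the first summand x, the
    sum has law N(x, t^2). By Tonelli x is integrated first, and [normal_pdf_mul] leaves a normal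
    density in x of total mass 1. *)
Lemma integral_normal_prob_shift {R : realType} (s t : R) (A : set R) :
  0 < s -> 0 < t -> measurable A ->
  (\int[normal_prob 0 s]_x normal_prob x t A
   = normal_prob 0 (Num.sqrt (s ^+ 2 + t ^+ 2)) A)%E.
Proof.
move=> s0 t0 mA; set r := Num.sqrt _.
pose f (xz : R * R) : \bar R :=
  ((normal_pdf 0 s xz.1 * normal_pdf xz.1 t xz.2 * \1_A xz.2)%:E)%E.
have mf : measurable_fun setT f.
  apply/measurable_EFinP; apply: measurable_funM; first apply: measurable_funM.
  - by apply: measurableT_comp; [exact: measurable_normal_pdf|exact: measurable_fst].
  - exact: measurable_normal_pdf2.
  - by apply: measurableT_comp; [exact: measurable_indic|exact: measurable_snd].
have f0 x : (0 <= f x)%E by rewrite lee_fin !mulr_ge0// normal_pdf_ge0.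
have probE x u : (normal_prob x u A =
    \int[lebesgue_measure]_z (normal_pdf x u z * \1_A z)%:E)%E.
  rewrite /normal_prob integral_mkcond; apply: eq_integral => z _.
  by rewrite patchE indicE; case: ifP => _; rewrite ?mulr1 ?mulr0.
transitivity (\int[lebesgue_measure]_x \int[lebesgue_measure]_z f (x, z))%E.
  rewrite (@ge0_integral_density _ _ _ lebesgue_measure _ (normal_pdf 0 s)) //=.
  - apply: eq_integral => x _; rewrite probE muleC -ge0_integralZl//.
    + by apply: eq_integral => z _; rewrite /f/= -EFinM mulrA.
    + apply/measurable_EFinP; apply: measurable_funM; last exact: measurable_indic.
      exact: measurable_normal_pdf.
    + by move=> z _; rewrite lee_fin mulr_ge0// normal_pdf_ge0.
    + by rewrite lee_fin normal_pdf_ge0.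
  - exact: measurable_normal_pdf.
  - by move=> x; exact: normal_pdf_ge0.
  - under eq_fun do rewrite probE.
    apply: (@measurable_fun_fubini_tonelli_F _ _ _ _ _ lebesgue_measure
      (fun xz : R * R => (normal_pdf xz.1 t xz.2 * \1_A xz.2)%:E)).
      apply/measurable_EFinP; apply: measurable_funM.
        exact: measurable_normal_pdf2.
      by apply: measurableT_comp; [exact: measurable_indic|exact: measurable_snd].
    by move=> xz; rewrite lee_fin mulr_ge0// normal_pdf_ge0.
rewrite fubini_tonelli// probE; apply: eq_integral => z _.
have rr : 0 < s * t / r.
  by rewrite divr_gt0 ?mulr_gt0// sqrtr_gt0 addr_gt0// exprn_gt0.
rewrite /f /=.
under eq_integral => x _.
  rewrite normal_pdf_mul// -/r -mulrA [X in _ * X]mulrC mulrA EFinM.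
  over.
rewrite ge0_integralZl//.
- by rewrite integral_normal_pdf mule1.
- by apply/measurable_EFinP; exact: measurable_normal_pdf.
- by move=> x _; rewrite lee_fin normal_pdf_ge0.
- by rewrite lee_fin mulr_ge0// normal_pdf_ge0.
Qed.

(** * Integrability of the logarithm *)

Lemma lebesgue_measure_ball0 {R : realType} (e : R) : 0 <= e ->
  lebesgue_measure [set x : R | `|x| <= e] = (2 * e)%:E.
Proof.
move=> e0; have -> : [set x : R | `|x| <= e] = `[- e, e]%classic.
  by apply/seteqP; split => x /=; rewrite in_itv/= ler_norml.
rewrite lebesgue_measure_itv/= lte_fin; case: ltP => ee.
  by rewrite -EFinB; congr EFin; ring.
by congr EFin; lra.
Qed.

Lemma measurable_ln_norm {R : realType} :
  measurable_fun setT (fun x : R => ln `|x|).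
Proof. by apply: measurableT_comp => //; exact: measurable_ln. Qed.

Lemma measurable_ball0 {R : realType} (e : R) : measurable [set x : R | `|x| <= e].
Proof.
have -> : [set x : R | `|x| <= e] = `[- e, e]%classic.
  by apply/seteqP; split => x /=; rewrite in_itv/= ler_norml.
exact: measurable_itv.
Qed.

(* Layer cake: for 0 < |x| < 1 the series counts the n <= -ln |x|. *)
Lemma norm_ln_norm_le {R : realType} (x : R) :
  (`|ln `|x| |%:E <= (expR (x ^+ 2 / 4))%:E +
    \sum_(n <oo) (\1_[set y : R | (`|y| <= expR (- n%:R))%R] x)%:E)%E.
Proof.
have sum0 : (0 <= \sum_(n <oo)
    (\1_[set y : R | (`|y| <= expR (- n%:R))%R] x)%:E :> \bar R)%E.
  by apply: nneseries_ge0 => n _ _; rewrite lee_fin.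
(* The convention ln 0 = 0 makes the left side vanish here. *)
have [x0|x0] := eqVneq x 0.
  by rewrite {1}x0 normr0 ln0// normr0 adde_ge0// lee_fin expR_ge0.
have nx0 : 0 < `|x| by rewrite normr_gt0.
have [x1|x1] := leP 1 `|x|.
  rewrite ger0_norm ?ln_ge0//; apply: (@le_trans _ _ (expR (x ^+ 2 / 4))%:E).
    (* ln |x| < |x| <= 1 + x^2/4 <= exp(x^2/4), the middle inequality being (|x| - 2)^2 >= 0. The
       constant 4 also keeps exp(x^2/4) integrable against exp(-x^2/2). *)
    rewrite lee_fin (le_trans (ltW (ln_sublinear nx0)))//.
    apply: le_trans (expR_ge1Dx _); rewrite -real_normK ?num_real//.
    by have := sqr_ge0 (`|x| - 2); lra.
  by rewrite leeDl.
set l := - ln `|x|.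
have l0 : 0 <= l by rewrite /l oppr_ge0 ln_le0// ltW.
have -> : `|ln `|x| | = l by rewrite ler0_norm// -oppr_ge0.
(* The terms n = 0, ..., floor(l) all equal 1, and there are floor(l) + 1 > l of them. *)
apply: (@le_trans _ _ (\sum_(0 <= n < (Num.truncn l).+1)
    (\1_[set y : R | (`|y| <= expR (- n%:R))%R] x)%:E)%E); last first.
  apply: (@le_trans _ _ (\sum_(n <oo)
    (\1_[set y : R | (`|y| <= expR (- n%:R))%R] x)%:E)%E).
    by apply: nneseries_lim_ge => n _ _; rewrite lee_fin.
  by rewrite leeDr// lee_fin expR_ge0.
rewrite sumEFin lee_fin (eq_big_nat _ _ (F2 := fun=> 1)).
  rewrite big_const_nat subn0 iter_addr addr0.
  by rewrite ltW// truncnS_gt.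
move=> n /andP[_ nl]; rewrite indicE mem_set//=.
rewrite -[leLHS]lnK ?posrE// ler_expR lerNr -/l.
by rewrite -truncn_ge_nat.
Qed.

(** Both parts of the dominating function in [norm_ln_norm_le] have finite mean: the exponential
    turns N(0,1) into a multiple of N(0,2), and the n-th ball has probability at most its length
    times the peak of the density, which is summable. *)
Lemma integrable_ln_norm_normal_prob {R : realType} :
  (normal_prob 0 1).-integrable setT (fun x : R => (ln `|x|)%:E).
Proof.
apply/integrableP; split.
  by apply/measurable_EFinP; exact: measurable_ln_norm.
pose B n := [set y : R | `|y| <= expR (- n%:R)].
have mB n : measurable (B n) by exact: measurable_ball0.
have mexp : measurable_fun setT (fun x : R => (expR (x ^+ 2 / 4))%:E).
  apply/measurable_EFinP; apply: measurableT_comp => //.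
  by apply: measurable_funM => //; exact: measurable_funX.
have mind n : measurable_fun setT (fun x : R => (\1_(B n) x)%:E : \bar R).
  by apply/measurable_EFinP; exact: measurable_indic.
have msum : measurable_fun setT
    (fun x : R => \sum_(n <oo) (\1_(B n) x)%:E : \bar R)%E.
  by apply: ge0_emeasurable_sum => // n x _ _; rewrite lee_fin.
have sum0 (x : R) : (0 <= \sum_(n <oo) (\1_(B n) x)%:E :> \bar R)%E.
  by apply: nneseries_ge0 => n _ _; rewrite lee_fin.
apply: (@le_lt_trans _ _ (\int[normal_prob 0 1]_x
    ((expR (x ^+ 2 / 4))%:E + \sum_(n <oo) (\1_(B n) x)%:E))%E).
  apply: ge0_le_integral => //.
  - apply: measurableT_comp => //; apply/measurable_EFinP.
    exact: measurable_ln_norm.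
  - exact: emeasurable_funD.
  - by move=> x _; exact: norm_ln_norm_le.
rewrite ge0_integralD//.
apply: lte_add_pinfty.
  rewrite (@ge0_integral_density _ _ _ lebesgue_measure _ (normal_pdf 0 1)) //=.
  - have pdfE (x : R) : expR (x ^+ 2 / 4) * normal_pdf 0 1 x
        = (normal_peak 1 / normal_peak (Num.sqrt 2))
          * normal_pdf 0 (Num.sqrt 2) x.
      rewrite !normal_pdfE ?gt_eqF ?sqrtr_gt0// mulrCA [RHS]mulrA divfK; last first.
        by rewrite gt_eqF// normal_peak_gt0// gt_eqF ?sqrtr_gt0.
      rewrite /normal_fun -expRD; congr (_ * expR _).
      by rewrite sqr_sqrtr//; field.
    under eq_integral => x _ do rewrite -EFinM pdfE EFinM.
    rewrite integralZl//; last exact: integrable_normal_pdf.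
    by rewrite integral_normal_pdf mule1 ltry.
  - exact: measurable_normal_pdf.
  - by move=> x; exact: normal_pdf_ge0.
rewrite integral_nneseries//.
(* Since e >= 2, the n-th term is at most peak * 2 * 2^-n, which is (4 * peak) / 2^(n+1), the form
   summed by [epsilon_trick0]. *)
apply: (@le_lt_trans _ _ (\sum_(n <oo)
    ((4 * normal_peak 1) / (2 ^ n.+1)%:R)%:E)%E); last first.
  apply: le_lt_trans (epsilon_trick0 xpredT _) _.
    by rewrite mulr_ge0// normal_peak_ge0.
  by rewrite ltry.
apply: lee_nneseries => n _.
  by move=> _; apply: integral_ge0 => x _; rewrite lee_fin.
rewrite integral_indic ?setIT; [|exact: measurableT|exact: mB].
rewrite /normal_prob.
apply: (@le_trans _ _ (\int[lebesgue_measure]_(x in B n) (normal_peak 1)%:E)%E).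
  apply: ge0_le_integral => //.
  - exact: mB.
  - by move=> x _; rewrite lee_fin normal_pdf_ge0.
  - by apply/measurable_funTS/measurable_EFinP; exact: measurable_normal_pdf.
  - by move=> x _; rewrite lee_fin normal_pdf_ub.
rewrite integral_cst; last exact: mB.
rewrite /= lebesgue_measure_ball0 ?expR_ge0//.
rewrite -EFinM lee_fin expRN.
have -> : 4 * normal_peak 1 / (2 ^ n.+1)%:R = normal_peak 1 * (2 * (2 ^+ n)^-1) :> R.
  by rewrite natrX exprS; field; rewrite expf_neq0.
rewrite ler_wpM2l ?normal_peak_ge0// ler_wpM2l//.
rewrite lef_pV2 ?posrE ?exprn_gt0 ?expR_gt0//.
rewrite -[n%:R]mulr1 expRM_natl lerXn2r ?nnegrE ?expR_ge0//.
exact: expR_ge1Dx.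
Qed.

(** * Independence *)

(** The constant [c] lets [Q] be a probability restricted to an event of probability [c], so that
    independence from that event survives the addition. *)
Lemma normal_prob_convolution {R : realType} {dT : measure_display}
    {T : measurableType dT} (Q : {measure set T -> \bar R}) (U V : T -> R)
    (c s t : R) :
  measurable_fun setT U -> measurable_fun setT V -> 0 <= c -> 0 < s -> 0 < t ->
  (forall A B, measurable A -> measurable B ->
    Q (U @^-1` A `&` V @^-1` B) = c%:E * (normal_prob 0 s A * normal_prob 0 t B))%E ->
  forall A, measurable A ->
    Q ((fun w => U w + V w) @^-1` A)
    = (c%:E * normal_prob 0 (Num.sqrt (s ^+ 2 + t ^+ 2)) A)%E.
Proof.
move=> mU mV c0 s0 t0 QE A mA.
pose UV (w : T) : measurableTypeR R * measurableTypeR R := (U w, V w).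
have mUV : measurable_fun setT UV by exact/measurable_fun_pair.
pose X := [set x : R * R | A (x.1 + x.2)].
have mX : measurable X.
  rewrite -[X]setTI.
  have : measurable_fun setT (fun x : R * R => x.1 + x.2).
    by apply: measurable_funD; [exact: measurable_fst|exact: measurable_snd].
  by apply.
(* Here [c] cannot be divided out, but the hypothesis on [setT] shows that [Q] is the zero
   measure. *)
have [c00|c00] := eqVneq c 0.
  rewrite c00 mul0e; apply/eqP; rewrite -measure_le0.
  have <- : Q setT = 0%E.
    have := QE setT setT measurableT measurableT.
    by rewrite !preimage_setT setTI c00 mul0e.
  apply: le_measure => //; rewrite inE//.
  rewrite -[X in measurable X]setTI.
  by apply: measurable_funD.
have c1 : 0 <= c^-1 by rewrite invr_ge0.
have nuE Z : mscale (NngNum c1) (image_measure Q UV mUV) Z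
    = (c^-1%:E * Q (UV @^-1` Z))%E by [].
(* After normalisation by [c] the joint law of (U, V) agrees with the product measure on rectangles,
   hence everywhere. *)
have prodE : (normal_prob 0 s \x normal_prob 0 t)%E X =
    mscale (NngNum c1) (image_measure Q UV mUV) X.
  apply: product_measure_unique => // A' B' mA' mB'.
  apply: (etrans (nuE _)); rewrite (_ : UV @^-1` _ = U @^-1` A' `&` V @^-1` B')//.
  by rewrite QE// muleA -EFinM mulVf// mul1e.
have -> : normal_prob 0 (Num.sqrt (s ^+ 2 + t ^+ 2)) A =
    (normal_prob 0 s \x normal_prob 0 t)%E X.
  apply: (etrans (esym (integral_normal_prob_shift _ _ _ s0 t0 mA))).
  rewrite /product_measure1; apply: eq_integral => x _ /=.
  have -> : xsection X x = (fun y => 1 * y + x) @^-1` A.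
    by apply/seteqP; split => y; rewrite /xsection/= inE /X/= mul1r addrC.
  by rewrite normal_prob_affine ?gt_eqF// mulr0 add0r mul1r.
by rewrite prodE nuE muleA -EFinM mulfV// mul1e.
Qed.

Section independence.
Context {R : realType} {dT : measure_display} {T : measurableType dT}.
Variable P : probability T R.

(** In [A], both sides are finite measures that agree on the pi-system [G]. *)
Lemma indep_g_sigma_algebra (G : set (set T)) (F : set T) :
  G `<=` measurable -> setI_closed G -> G setT -> measurable F ->
  (forall A, G A -> P (A `&` F) = P A * P F)%E ->
  forall A, <<s G >> A -> (P (A `&` F) = P A * P F)%E.
Proof.
move=> mG IG GT mF GF A sGA.
have PF : P F \is a fin_num by exact: fin_num_measure.
have PF0 : 0 <= fine (P F) by exact: fine_ge0.
have mE B : mscale (NngNum PF0) P B = (P B * P F)%E.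
  by rewrite -[LHS]/((fine (P F))%:E * P B)%E fineK// muleC.
rewrite -mE -[LHS]/(mrestr P mF A).
apply: (g_sigma_algebra_measure_unique G mG (fun=> setT)) => //.
- by rewrite bigcup_const.
- by move=> B GB; exact: etrans (GF _ GB) (esym (mE B)).
- move=> _; suff : (P (setT `&` F) < +oo)%E by [].
  by rewrite setTI ltey_eq PF.
Qed.

Definition product_rule {n : nat} (E : 'I_n -> set T) :=
  P (\bigcap_(j in [set: 'I_n]) E j) = (\prod_(j < n) P (E j))%E.

Lemma measurable_bigcap_ord (n : nat) (D : set 'I_n) (E : 'I_n -> set T) :
  (forall j, measurable (E j)) -> measurable (\bigcap_(j in D) E j).
Proof. by move=> mE; apply: fin_bigcap_measurable => //; exact: finite_finset. Qed.

Lemma bigcap_ord_D1 (n : nat) (E : 'I_n -> set T) (i : 'I_n) :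
  \bigcap_(j in [set: 'I_n]) E j = E i `&` \bigcap_(j in [set j | j != i]) E j.
Proof.
apply/seteqP; split => [w Ew|w [Ei Ew] j _].
  by split => [|j _]; exact: Ew.
by have [->//|ji] := eqVneq j i; exact: Ew.
Qed.

Lemma product_rule_replace (n : nat) (E : 'I_n -> set T) (i : 'I_n) (A : set T) :
  product_rule (fun j => if j == i then A else E j) ->
  (P (A `&` \bigcap_(j in [set j | j != i]) E j) =
   P A * \prod_(j < n | j != i) P (E j))%E.
Proof.
rewrite /product_rule (bigcap_ord_D1 _ _ i) (bigD1 i)//= eqxx.
have -> : \bigcap_(j in [set j | j != i]) (if j == i then A else E j) =
    \bigcap_(j in [set j | j != i]) E j.
  by apply: eq_bigcapr => j /= /negbTE ->.
move=> ->; congr (_ * _)%E.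
by apply: eq_bigr => j /negbTE ->.
Qed.

(** The rule with [setT] at [i] evaluates the probability of the other events; comparing it with the
    rule for [A] shows that [A] is independent of their intersection. *)
Lemma product_rule_D1 (n : nat) (E : 'I_n -> set T) (i : 'I_n) (A : set T) :
  product_rule (fun j => if j == i then setT else E j) ->
  product_rule (fun j => if j == i then A else E j) ->
  (P (A `&` \bigcap_(j in [set j | j != i]) E j) =
   P A * P (\bigcap_(j in [set j | j != i]) E j))%E.
Proof.
move=> /product_rule_replace; rewrite setTI probability_setT mul1e => ->.
exact: product_rule_replace.
Qed.

(* Induction on the number k of indices at which the generating pi-system has
   already been replaced by its sigma-algebra. *)
Lemma product_rule_g_sigma_algebra (n : nat) (G : 'I_n -> set (set T)) :
  (forall j, G j `<=` measurable) -> (forall j, setI_closed (G j)) ->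
  (forall j, G j setT) ->
  (forall E, (forall j, G j (E j)) -> product_rule E) ->
  forall E, (forall j, <<s G j >> (E j)) -> product_rule E.
Proof.
move=> mG IG GT GE.
have msG j A : <<s G j >> A -> measurable A.
  by apply: smallest_sub; [exact: sigma_algebra_measurable|exact: mG].
suff H k : forall E : 'I_n -> set T,
    (forall j : 'I_n, (j < k)%N -> <<s G j >> (E j)) ->
    (forall j : 'I_n, (k <= j)%N -> G j (E j)) -> product_rule E.
  move=> E sE; apply: (H n) => j nj; first exact: (sE j).
  by have := ltn_ord j; rewrite ltnNge nj.
elim: k => [|k IH] E sE GEk; first by apply: GE => j; exact: (GEk j).
have [nk|kn] := leqP n k.
  apply: IH => j kj; first exact: (sE j (ltnW kj)).
  by have := ltn_ord j; rewrite ltnNge (leq_trans nk kj).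
pose i := Ordinal kn.
have mEj j : measurable (E j).
  have [jk|kj] := ltnP j k.+1; first exact: (msG j _ (sE j jk)).
  exact: (mG j _ (GEk j kj)).
(* With a generator at index k the induction hypothesis applies; then all other events are frozen in
   [F], and only the event at k passes to its sigma-algebra. *)
have ruleA A : G i A -> product_rule (fun j => if j == i then A else E j).
  move=> GA; apply: IH => j.
    move=> jk; rewrite ifF; first exact: (sE j (ltnW jk)).
    by apply/negbTE; rewrite neq_ltn jk.
  rewrite leq_eqVlt => /predU1P[kj|kj].
    have ji : j = i by exact/val_inj.
    by rewrite ji eqxx.
  rewrite ifF; first exact: (GEk j kj).
  by apply/negbTE; rewrite neq_ltn kj orbT.
set F := \bigcap_(j in [set j | j != i]) E j.
have mF : measurable F by exact: measurable_bigcap_ord.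
have PF : P F = (\prod_(j < n | j != i) P (E j))%E.
  have := product_rule_replace _ _ _ _ (ruleA _ (GT i)).
  by rewrite setTI probability_setT mul1e.
rewrite /product_rule (bigcap_ord_D1 _ _ i) -/F (bigD1 i)//= -PF.
apply: (indep_g_sigma_algebra (G i)) => //; last exact: sE.
by move=> A GA; apply: product_rule_D1; exact: ruleA.
Qed.

End independence.

(** * Sums of independent Gaussian blocks *)

Section gaussian_blocks.
Context {R : realType} {dT : measure_display} {T : measurableType dT}.
Variable P : probability T R.

(** The cylinders of one block form a pi-system on which the hypothesis is the product rule, and the
    block sum is measurable for the sigma-algebra they generate. *)
Lemma product_rule_block_sums (n d : nat) (B : 'I_n -> 'I_d -> T -> R)
    (A : 'I_n -> set R) :
  (forall j k, measurable_fun setT (B j k)) ->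
  mutually_independent_vectors P B -> (forall j, measurable (A j)) ->
  product_rule P (fun j => (fun w => \sum_(k < d) B j k w) @^-1` A j).
Proof.
move=> mB indB mA.
pose cyl j (C : 'I_d -> set R) := \bigcap_(k in [set: 'I_d]) (B j k @^-1` C k).
pose G j := [set cyl j C | C in [set C | forall k, measurable (C k)]].
apply: (product_rule_g_sigma_algebra P n G).
- move=> j _ [C mC <-]; apply: measurable_bigcap_ord => k.
  by rewrite -[X in measurable X]setTI; exact: mB.
- move=> j _ _ [C mC <-] [C' mC' <-].
  exists (fun k => C k `&` C' k); first by move=> k; exact: measurableI.
  by rewrite /cyl -bigcapI; apply: eq_bigcapr => k _; rewrite preimage_setI.
- move=> j; exists (fun=> setT) => //.
  by apply/seteqP; split.
- move=> E GE.
  have /choice[C HC] : forall j, exists C, (forall k, measurable (C k)) /\ cyl j C = E j.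
    by move=> j; have [C mC <-] := GE j; exists C.
  have := indB C (fun j k => (HC j).1 k).
  rewrite /product_rule.
  rewrite (eq_bigcapr (G := E)); last by move=> j _; exact: (HC j).2.
  by move=> ->; apply: eq_bigr => j _; congr (P _); exact: (HC j).2.
move=> j.
(* Equipping [T] with the sigma-algebra generated by [G j] turns measurability of the sum into the
   required membership. *)
pose Tj := g_sigma_algebraType (G j).
have mBj k : measurable_fun setT (B j k : Tj -> R).
  move=> _ Y mY; rewrite setTI; apply: sub_sigma_algebra.
  exists (fun k' => if k' == k then Y else setT); first by move=> k'; case: ifP.
  apply/seteqP; split => [w /(_ k I)/=|w /= Yw k' _ /=]; first by rewrite eqxx.
  by case: eqP => [->|].
have := @measurable_sum _ Tj R setT _ (index_enum 'I_d) (B j) mBj.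
by move=> /(_ measurableT (A j) (mA j)); rewrite setTI.
Qed.

Section iid_gaussian.
Variables (n : nat) (W : 'I_n -> T -> R) (v : R).
Hypotheses (v0 : 0 < v) (mW : forall j, measurable_fun setT (W j)).
Hypothesis lawW : forall j A, measurable A ->
  P (W j @^-1` A) = normal_prob 0 (Num.sqrt v) A.
Hypothesis indW : forall C : 'I_n -> set R, (forall j, measurable (C j)) ->
  product_rule P (fun j => W j @^-1` C j).

Let cyl (C : 'I_n -> set R) := \bigcap_(j in [set: 'I_n]) (W j @^-1` C j).

Let measurable_cyl (C : 'I_n -> set R) :
  (forall j, measurable (C j)) -> measurable (cyl C).
Proof.
move=> mC; apply: measurable_bigcap_ord => j.
by rewrite -[X in measurable X]setTI; exact: mW.
Qed.

Let cylI1 (C : 'I_n -> set R) (i : 'I_n) (A : set R) : C i = setT ->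
  W i @^-1` A `&` cyl C = cyl (fun j => if j == i then A else C j).
Proof.
move=> Ci; apply/seteqP; split => [w [Aw Cw] j _ /=|w Cw].
  by case: eqP => [->//|_]; exact: Cw.
split; first by have := Cw i I; rewrite /= eqxx.
move=> j _ /=; have := Cw j I; rewrite /=; case: eqP => // -> _.
by rewrite Ci.
Qed.

(** [C i = setT] means that the cylinder does not constrain [W i], which is therefore independent of
    it. *)
Let law_cyl1 (C : 'I_n -> set R) (i : 'I_n) (A : set R) :
  (forall j, measurable (C j)) -> C i = setT -> measurable A ->
  (P (W i @^-1` A `&` cyl C) = P (cyl C) * normal_prob 0 (Num.sqrt v) A)%E.
Proof.
move=> mC Ci mA.
have mC' A' : measurable A' ->
    forall j, measurable (if j == i then A' else C j).
  by move=> mA' j; case: ifP.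
have bigE A' : (\prod_(j < n | j != i) P (W j @^-1` (if j == i then A' else C j))
    = \prod_(j < n | j != i) P (W j @^-1` C j))%E.
  by apply: eq_bigr => j /negbTE ->.
rewrite cylI1// -[in RHS](setTI (cyl C)) -[X in (P (X `&` _) * _)%E](preimage_setT (W i)).
rewrite cylI1// /cyl (indW _ (mC' _ mA)) (indW _ (mC' _ measurableT)).
rewrite (bigD1 i)//= bigE [in RHS](bigD1 i)//= bigE !eqxx.
by rewrite preimage_setT probability_setT mul1e muleC lawW.
Qed.

(* The cylinder over the remaining coordinates makes the induction hypothesis
   say that the partial sum is independent of the next summand. *)
Lemma iid_gaussian_sum_cyl (sigma : nat -> 'I_n) (k : nat) (C : 'I_n -> set R)
    (A : set R) :
  (forall a b, (a <= k)%N -> (b <= k)%N -> sigma a = sigma b -> a = b) ->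
  (forall j, measurable (C j)) -> (forall b, (b <= k)%N -> C (sigma b) = setT) ->
  measurable A ->
  (P ((fun w => (\sum_(b < k.+1) W (sigma b) w)%R) @^-1` A `&` cyl C)
   = P (cyl C) * normal_prob 0 (Num.sqrt (v * k.+1%:R)) A)%E.
Proof.
elim: k C A => [|k IH] C A inj mC CT mA.
  rewrite mulr1 (_ : (fun w => _) = W (sigma 0%N)).
    by apply: law_cyl1 => //; exact: CT.
  by apply/funext => w; rewrite big_ord1.
have mF := measurable_cyl _ mC.
set F := cyl C in mF *; set s := sigma k.+1.
pose U w := \sum_(b < k.+1) W (sigma b) w.
have -> : (fun w => \sum_(b < k.+2) W (sigma b) w) = (fun w => U w + W s w).
  by apply/funext => w; rewrite big_ord_recr.
have mU : measurable_fun setT U by exact: measurable_sum.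
have PF : P F \is a fin_num by exact: fin_num_measure.
have vk : 0 < v * k.+1%:R by rewrite mulr_gt0// ltr0n.
(* The convolution is taken under [P] restricted to [F], with total mass [P F] as the constant. *)
have := @normal_prob_convolution _ _ _ (mrestr P mF) U (W s) (fine (P F))
  (Num.sqrt (v * k.+1%:R)) (Num.sqrt v) mU (mW s).
rewrite fine_ge0// !sqrtr_gt0 fineK// => /(_ isT vk v0) conv.
have -> : v * k.+2%:R
    = Num.sqrt (v * k.+1%:R) ^+ 2 + Num.sqrt v ^+ 2.
  by rewrite !sqr_sqrtr ?ltW// -[k.+2]addn1 natrD mulrDr mulr1.
apply: conv => // A1 B mA1 mB.
rewrite -[LHS]/(P (U @^-1` A1 `&` W s @^-1` B `&` F)) -setIA.
(* The event on the new summand [W s] is absorbed into the cylinder. By injectivity [s] differs from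
   the earlier indices, so the induction hypothesis applies to the enlarged cylinder. *)
rewrite cylI1 ?CT//.
have mC' j : measurable (if j == s then B else C j) by case: ifP.
rewrite IH//.
- rewrite -cylI1 ?CT// law_cyl1 ?CT// muleAC -muleA.
  by rewrite [X in (_ * X)%E]muleC.
- by move=> a b ak bk; apply: inj; exact: leqW.
- move=> b bk; rewrite ifF ?CT//; first exact: leqW.
  apply/negbTE/eqP => /inj bk1; have := bk.
  by rewrite (bk1 (leqW bk) (leqnn _)) ltnn.
Qed.

Lemma iid_gaussian_sum (sigma : nat -> 'I_n) (m : nat) (A : set R) :
  (0 < m)%N ->
  (forall a b, (a < m)%N -> (b < m)%N -> sigma a = sigma b -> a = b) ->
  measurable A ->
  P ((fun w => \sum_(b < m) W (sigma b) w) @^-1` A)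
  = normal_prob 0 (Num.sqrt (v * m%:R)) A.
Proof.
case: m => // k _ inj mA.
have := iid_gaussian_sum_cyl sigma k (fun=> setT) A inj (fun=> measurableT).
move=> /(_ (fun _ _ => erefl) mA).
have -> : cyl (fun=> setT) = setT.
  by apply/seteqP; split.
by rewrite setIT probability_setT mul1e.
Qed.

End iid_gaussian.
End gaussian_blocks.

(** * Expectation of the statistic *)

Section has_expectation.
Context {R : realType} {dT : measure_display} {T : measurableType dT}.
Variable P : probability T R.

(** Additivity of the integral requires integrability, so it travels with the value; the expectation
    of a linear combination can then be assembled as a term. *)
Definition has_expectation (f : T -> R) (e : R) :=
  P.-integrable setT (EFin \o f) /\ (\int[P]_w (f w)%:E)%E = e%:E.

Lemma has_expectationD (f g : T -> R) (a b : R) :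
  has_expectation f a -> has_expectation g b ->
  has_expectation (fun w => f w + g w) (a + b).
Proof.
move=> [intf Ef] [intg Eg]; split; first exact: (integrableD _ intf intg).
under eq_integral do rewrite EFinD.
by rewrite integralD// Ef Eg.
Qed.

Lemma has_expectationZ (f : T -> R) (c a : R) :
  has_expectation f a -> has_expectation (fun w => c * f w) (c * a).
Proof.
move=> [intf Ef]; split; first exact: (integrableZl _ c intf).
under eq_integral do rewrite EFinM.
by rewrite integralZl// Ef.
Qed.

Lemma has_expectation_cst (c : R) : has_expectation (fun=> c) c.
Proof.
split; first exact: finite_measure_integrable_cst.
by rewrite integral_cst//= probability_setT mule1.
Qed.

Lemma has_expectation_sum (I : Type) (s : seq I) (f : I -> T -> R) (e : I -> R) :
  (forall i, has_expectation (f i) (e i)) ->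
  has_expectation (fun w => \sum_(i <- s) f i w) (\sum_(i <- s) e i).
Proof.
move=> fe; elim: s => [|i s IH].
  rewrite big_nil (_ : (fun w => _) = fun=> 0); first exact: has_expectation_cst.
  by apply/funext => w; rewrite big_nil.
rewrite big_cons (_ : (fun w => _) = fun w => f i w + \sum_(j <- s) f j w).
  exact: has_expectationD.
by apply/funext => w; rewrite big_cons.
Qed.

End has_expectation.

(** Both integrals are integrals of [f] against the common image law. The same remark for |f|
    transfers integrability. *)
Lemma integral_eq_law {R : realType} {d1 d2 d3 : measure_display}
    {T1 : measurableType d1} {T2 : measurableType d2} {T3 : measurableType d3}
    (mu1 : {measure set T1 -> \bar R}) (mu2 : {measure set T2 -> \bar R})
    (phi1 : T1 -> T3) (phi2 : T2 -> T3) (f : T3 -> \bar R) :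
  measurable_fun setT phi1 -> measurable_fun setT phi2 -> measurable_fun setT f ->
  (forall A, measurable A -> mu1 (phi1 @^-1` A) = mu2 (phi2 @^-1` A)) ->
  mu2.-integrable setT (f \o phi2) ->
  mu1.-integrable setT (f \o phi1) /\
  (\int[mu1]_x f (phi1 x) = \int[mu2]_x f (phi2 x))%E.
Proof.
move=> mphi1 mphi2 mf law int2.
have law_integral (g : T3 -> \bar R) :
    (\int[pushforward mu1 phi1]_y g y = \int[pushforward mu2 phi2]_y g y)%E.
  change (\int[image_measure mu1 phi1 mphi1]_y g y
     = \int[image_measure mu2 phi2 mphi2]_y g y)%E.
  by apply: eq_measure_integral => A mA _; exact: law.
have int1 : mu1.-integrable setT (f \o phi1).
  apply/integrableP; split; first exact: measurableT_comp.
  have /integrableP[_] := int2; apply: le_lt_trans.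
  have := law_integral (abse \o f).
  have mabsf : measurable_fun setT (abse \o f) by exact: measurableT_comp.
  have abs0 : {in setT, forall y, 0 <= (abse \o f) y}%E.
    by move=> y _; exact: abse_ge0.
  rewrite (ge0_integral_pushforward mphi1 _ measurableT mabsf abs0).
  rewrite (ge0_integral_pushforward mphi2 _ measurableT mabsf abs0).
  by rewrite !preimage_setT => ->.
split=> //; have := law_integral f.
have E1 := integral_pushforward mphi1 mf (D := setT) int1 measurableT.
have E2 := integral_pushforward mphi2 mf (D := setT) int2 measurableT.
by rewrite E1 E2 !preimage_setT.
Qed.

(** E ln |Z| for Z standard normal, finite by [integrable_ln_norm_normal_prob]. *)
Definition mean_ln_norm_normal {R : realType} : R :=
  fine (\int[normal_prob 0 1]_x (ln `|x : R|)%:E)%E.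

Lemma normal_prob_set1 {R : realType} (m s x : R) : normal_prob m s [set x] = 0%E.
Proof.
have /null_content_dominatesP := normal_prob_dominates m s; apply => //.
exact: (lebesgue_measure_set1 x).
Qed.

Lemma has_expectation_ln_norm_gaussian {R : realType} {dT : measure_display}
    {T : measurableType dT} (P : probability T R) (V : T -> R) (v : R) :
  measurable_fun setT V -> 0 < v ->
  (forall A, measurable A -> P (V @^-1` A) = normal_prob 0 (Num.sqrt v) A) ->
  has_expectation P (fun w => ln `|V w|) (ln v / 2 + mean_ln_norm_normal).
Proof.
move=> mV v0 lawV; set s := Num.sqrt v.
have s0 : 0 < s by rewrite sqrtr_gt0.
have lns : ln s = ln v / 2.
  by rewrite -[v in RHS]sqr_sqrtr ?ltW// -/s lnXn//; field.
pose N : probability _ R := normal_prob (0 : R) 1.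
have mf : measurable_fun setT (fun x : R => (ln `|x|)%:E).
  by apply/measurable_EFinP; exact: measurable_ln_norm.
(* With ln 0 = 0 the identity ln |s x| = ln s + ln |x| can fail at x = 0. The indicator corrects
   this, and has mean 1 because N(0,1) has no atom. *)
have lnE (x : R) : ln `|s * x + 0| = ln s * \1_(~` [set (0 : R)]) x + ln `|x|.
  rewrite addr0 normrM gtr0_norm// indicE; have [->|x0] := eqVneq x 0.
    by rewrite memNset ?normr0 ?mulr0 ?ln0 ?addr0//= => /(_ erefl).
  by rewrite mem_set ?mulr1 ?lnM ?posrE ?normr_gt0//=; exact/eqP.
have N0 : has_expectation N (\1_(~` [set (0 : R)])) 1.
  split; first by apply: integrable_indic; exact: measurableC.
  transitivity (N (~` [set (0 : R)])).
    by rewrite integral_indic ?setIT//; exact: measurableC.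
  rewrite probability_setC// (_ : N _ = 0%E) ?sube0//.
  exact: normal_prob_set1.
have N1 : has_expectation N (fun x => ln `|x|) mean_ln_norm_normal.
  split; first exact: integrable_ln_norm_normal_prob.
  rewrite fineK//; apply: integrable_fin_num => //.
  exact: integrable_ln_norm_normal_prob.
have Ns : has_expectation N (fun x => ln `|s * x + 0|) (ln s + mean_ln_norm_normal).
  rewrite (_ : (fun x => _) = (fun x => ln s * \1_(~` [set (0 : R)]) x + ln `|x|)).
    rewrite -[X in X + _]mulr1; apply: has_expectationD => //.
    exact: has_expectationZ.
  exact/funext.
have law A : measurable A -> P (V @^-1` A) = N ((fun x => s * x + 0) @^-1` A).
  move=> mA; rewrite lawV//.
  by apply/esym; rewrite /N/= normal_prob_affine// mulr0 addr0 mulr1.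
have [int E] := integral_eq_law P N V (fun x => s * x + 0) _
  mV (measurable_affine s 0) mf law Ns.1.
split; first exact: int.
by rewrite E Ns.2 lns.
Qed.

Lemma big_ord_mul {V : zmodType} (F : nat -> V) (n d : nat) :
  \sum_(i < n * d) F i = \sum_(j < n) \sum_(k < d) F (j * d + k)%N.
Proof.
elim: n => [|n IH]; first by rewrite mul0n !big_ord0.
rewrite big_ord_recr/= -IH -(big_mkord xpredT F) mulSn addnC.
rewrite (big_cat_nat _ (leq_addr d (n * d)))//= big_mkord; congr (_ + _).
rewrite -{1}[(n * d)%N]add0n big_addn addKn big_mkord.
by apply: eq_bigr => k _; rewrite addnC.
Qed.

Lemma gaussian_vector_law {R : realType} {dT : measure_display}
    {T : measurableType dT} (P : probability T R) (d : nat)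
    (V : 'I_d -> T -> R) (S : 'M[R]_d) (u : 'rV[R]_d) (A : set R) :
  centered_gaussian_vector P V S -> 0 < (u *m S *m u^T) 0 0 -> measurable A ->
  P ((fun w => \sum_(k < d) u 0 k * V k w) @^-1` A)
  = normal_prob 0 (Num.sqrt ((u *m S *m u^T) 0 0)) A.
Proof.
move=> [_ lawV] S0 mA; rewrite lawV// /centered_gauss_law.
by rewrite (negbTE (lt0r_neq0 S0)).
Qed.

Lemma gaussian_vector_coord_law {R : realType} {dT : measure_display}
    {T : measurableType dT} (P : probability T R) (d : nat)
    (V : 'I_d -> T -> R) (S : 'M[R]_d) (k : 'I_d) (A : set R) :
  centered_gaussian_vector P V S -> 0 < S k k -> measurable A ->
  P (V k @^-1` A) = normal_prob 0 (Num.sqrt (S k k)) A.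
Proof.
move=> gV Sk mA; pose u : 'rV[R]_d := delta_mx 0 k.
have uS : (u *m S *m u^T) 0 0 = S k k.
  by rewrite /u trmx_delta -rowE -colE !mxE.
have uV : (fun w => \sum_(j < d) u 0 j * V j w) = V k.
  apply/funext => w; rewrite (bigD1 k)//= big1 ?addr0; last first.
    by move=> j jk; rewrite mxE (negbTE jk) andbF mul0r.
  by rewrite mxE !eqxx mul1r.
by have := gaussian_vector_law P d V S u A gV; rewrite uS uV => /(_ Sk mA).
Qed.

Lemma integral_scaling_stat (R : realType) (dT : measure_display)
    (T : measurableType dT) (P : probability T R) (K1 K2 d m : nat)
    (Sigma : 'M[R]_d) (X : nat -> T -> R) :
  (0 < K2)%N -> (0 < d)%N -> (0 < m)%N -> K1 = (d * m)%N ->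
  (forall k, 0 < Sigma k k) -> 0 < ones_quad Sigma ->
  mutually_independent_vectors P
    (fun (j : 'I_(m * K2)) (k : 'I_d) => X (j * d + k)%N) ->
  (forall j : 'I_(m * K2),
     centered_gaussian_vector P (fun k : 'I_d => X (j * d + k)%N) Sigma) ->
  (\int[P]_w (scaling_stat K1 K2 X w)%:E)%E
  = ((1 / 2) * ((ln (m%:R : R) + ln (ones_quad Sigma)
                 - (d%:R)^-1 * \sum_(i < d) ln (Sigma i i))
                / (ln (m%:R : R) + ln (d%:R : R))))%:E.
Proof.
move=> K2_gt0 d_gt0 m_gt0 K1E Skk S1 indX gX.
set c := @mean_ln_norm_normal R; set s := ones_quad Sigma in S1 *.
pose B (j : 'I_(m * K2)) (k : 'I_d) := X (j * d + k)%N.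
have mB j k : measurable_fun setT (B j k) by exact: (gX j).1.
pose W (j : 'I_(m * K2)) w := \sum_(k < d) B j k w.
have mW j : measurable_fun setT (W j) by exact: measurable_sum.
have lawW j A : measurable A -> P (W j @^-1` A) = normal_prob 0 (Num.sqrt s) A.
  move=> mA; rewrite -(gaussian_vector_law P d _ Sigma (const_mx 1) A (gX j))//.
  rewrite (_ : (fun w => _) = W j)//; apply/funext => w.
  by apply: eq_bigr => k _; rewrite mxE mul1r.
have indW (C : 'I_(m * K2) -> set R) : (forall j, measurable (C j)) ->
    product_rule P (fun j => W j @^-1` C j).
  exact: product_rule_block_sums.
have EX (j : 'I_(m * K2)) (k : 'I_d) : has_expectation P
    (fun w => ln `|X (j * d + k)%N w|) (ln (Sigma k k) / 2 + c).
  apply: (has_expectation_ln_norm_gaussian _ (B j k)) => // A mA.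
  exact: (gaussian_vector_coord_law P d (B j) Sigma k A (gX j)).
have mK2_gt0 : (0 < m * K2)%N by rewrite muln_gt0 m_gt0.
have EY (i : 'I_K2) : has_expectation P
    (fun w => ln `|\sum_(j < K1) X (j + i * K1)%N w|) (ln (s * m%:R) / 2 + c).
  (* As K1 = d m, the sum Y_i consists of the blocks i m, ..., i m + m - 1. The default index of
     [insubd] is never reached for b < m. *)
  pose sigma b : 'I_(m * K2) := insubd (Ordinal mK2_gt0) (i * m + b)%N.
  have sigmaE b : (b < m)%N -> sigma b = (i * m + b)%N :> nat.
    move=> bm; rewrite val_insubd ifT//.
    apply: (@leq_trans (i.+1 * m)); first by rewrite mulSn addnC ltn_add2r.
    by rewrite mulnC leq_mul2l ltn_ord orbT.
  have YE : (fun w => ln `|\sum_(j < K1) X (j + i * K1)%N w|) =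
      (fun w => ln `|\sum_(b < m) W (sigma b) w|).
    apply/funext => w; congr (ln `| _ |).
    rewrite K1E mulnC (big_ord_mul (fun j => X (j + i * (m * d))%N w)).
    apply: eq_bigr => b _; apply: eq_bigr => k _.
    rewrite /B sigmaE//; congr (X _ w); lia.
  rewrite YE; apply: has_expectation_ln_norm_gaussian.
  - exact: measurable_sum.
  - by rewrite mulr_gt0// ltr0n.
  - move=> A mA; apply: (iid_gaussian_sum P _ W) => //.
    move=> a b am bm /(congr1 (@nat_of_ord _)); rewrite !sigmaE//.
    by move/addnI.
have [_ E] := has_expectationZ P _ (ln (K1%:R : R))^-1 _ (has_expectationD P _ _ _ _
   (has_expectationZ P _ (K2%:R)^-1 _ (has_expectation_sum P _ (index_enum 'I_K2) _ _ EY))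
   (has_expectationZ P _ (- ((K1 * K2)%:R)^-1) _
     (has_expectation_sum P _ (index_enum 'I_(m * K2)) _ _ (fun j =>
       has_expectation_sum P _ (index_enum 'I_d) _ _ (EX j))))).
have statE w : scaling_stat K1 K2 X w = (ln (K1%:R : R))^-1 *
    ((K2%:R)^-1 * \sum_(i < K2) ln `|\sum_(j < K1) X (j + i * K1)%N w|
     + - ((K1 * K2)%:R)^-1 *
       \sum_(j < m * K2) \sum_(k < d) ln `|X (j * d + k)%N w|).
  rewrite /scaling_stat mulNr -(big_ord_mul (fun i => ln `|X i w|)).
  by have -> : (m * K2 * d = K1 * K2)%N by rewrite K1E [(d * m)%N]mulnC mulnAC.
under eq_integral do rewrite statE.
rewrite E; congr EFin.
have m0 : (0 : R) < m%:R by rewrite ltr0n.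
have d0 : (0 : R) < d%:R by rewrite ltr0n.
have K0 : (0 : R) < K2%:R by rewrite ltr0n.
have sumC n (x : R) : \sum_(i < n) x = n%:R * x.
  by rewrite sumr_const card_ord mulr_natl.
rewrite !sumC big_split/= sumC -mulr_suml K1E !natrM.
rewrite !lnM ?posrE// [ln d%:R + _]addrC.
(* The factor 1 / log K1 is matched as a whole and never cancelled, so K1 = 1, where it is the
   inverse of 0, needs no separate case. *)
rewrite [RHS]mulrA [RHS]mulrC; congr (_ * _).
field; by rewrite !lt0r_neq0.
Qed.

(** * The equicorrelation matrix and the range of the exponent *)

Section equicorrelation.
Context {R : realType}.
Variables (d : nat) (beta : R).
Let Sigma : 'M[R]_d :=
  beta *: ((const_mx 1 : 'cV[R]_d) *m (const_mx 1 : 'rV[R]_d))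
  + (1 - beta) *: 1%:M.

Lemma equicorrelation_diag (k : 'I_d) : Sigma k k = 1.
Proof. by rewrite !mxE big_ord1 !mxE eqxx mulr1n; ring. Qed.

Lemma ones_quad_equicorrelation :
  ones_quad Sigma = beta * d%:R ^+ 2 + (1 - beta) * d%:R.
Proof.
have sum1 : ((const_mx 1 : 'rV[R]_d) *m (const_mx 1 : 'cV[R]_d)) 0 0 = d%:R.
  rewrite !mxE (eq_bigr (fun=> 1)) ?sumr_const ?card_ord// => k _.
  by rewrite !mxE mulr1.
rewrite /ones_quad /Sigma trmx_const mulmxDr mulmxDl -!scalemxAr -!scalemxAl mulmx1.
have E (M N : 'M[R]_1) a b : (a *: M + b *: N) 0 0 = a * M 0 0 + b * N 0 0.
  by rewrite !mxE.
rewrite E sum1 mulmxA -(mulmxA (_ *m _)) [X in beta * X]mxE big_ord1 !sum1.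
by rewrite expr2.
Qed.

End equicorrelation.

(** The argument of the logarithm is affine in [beta], running from d to d^2, so the quotient of
    logarithms runs from 1 to 2. *)
Lemma image_scaling_exponent (R : realType) (d : nat) : (2 <= d)%N ->
  [set (1 / 2) * (ln (beta * (d%:R) ^+ 2 + (1 - beta) * d%:R) / ln (d%:R : R))
    | beta in `[(0 : R), 1]%classic] = `[1 / 2, 1]%classic.
Proof.
move=> d2.
have d1 : 1 < d%:R :> R by rewrite ltr1n.
have d0 : 0 < d%:R :> R by rewrite (lt_trans ltr01).
have l0 : 0 < ln (d%:R : R) by rewrite ln_gt0.
have dd : 0 < d%:R ^+ 2 - d%:R :> R by rewrite subr_gt0 -[ltLHS]expr1 ltr_eXn2l.
apply/seteqP; split => [_ [b /= +] <-|y /=]; rewrite !in_itv/= => /andP[].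
  move=> b0 b1; set q := _ + _.
  have qE : q = d%:R + b * (d%:R ^+ 2 - d%:R) by rewrite /q; ring.
  have dq : d%:R <= q by rewrite qE lerDl mulr_ge0// ltW.
  have qd : q <= d%:R ^+ 2.
    by rewrite qE addrC -lerBrDr ler_piMl// ltW.
  have q0 : 0 < q by exact: lt_le_trans dq.
  have lq : ln d%:R <= ln q by rewrite ler_ln.
  have ql : ln q <= ln d%:R * 2.
    by rewrite mulr_natr -lnXn// ler_ln// posrE exprn_gt0.
  have : 1 <= ln q / ln d%:R by rewrite ler_pdivlMr// mul1r.
  have : ln q / ln d%:R <= 2 by rewrite ler_pdivrMr// mulrC.
  by move=> h1 h2; apply/andP; split; lra.
(* q = d^(2y) is the value the argument must take; the witness for [beta] solves d + beta (d^2 - d)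
   = q. *)
move=> y1 y2; set q : R := expR (2 * y * ln d%:R).
have dq : d%:R <= q.
  rewrite -[leLHS]lnK ?posrE// ler_expR ler_peMl ?(ltW l0)//; lra.
have qd : q <= d%:R ^+ 2.
  rewrite -[leRHS]lnK ?posrE ?exprn_gt0// ler_expR lnXn// -[leRHS]mulr_natl.
  by rewrite ler_wpM2r ?(ltW l0)//; lra.
exists ((q - d%:R) / (d%:R ^+ 2 - d%:R)).
  rewrite /= in_itv/= divr_ge0 ?(ltW dd) ?subr_ge0//=.
  by rewrite ler_pdivrMr// mul1r lerD2r.
have -> : (q - d%:R) / (d%:R ^+ 2 - d%:R) * d%:R ^+ 2
    + (1 - (q - d%:R) / (d%:R ^+ 2 - d%:R)) * d%:R = q.
  by field; rewrite lt0r_neq0.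
by rewrite /q expRK; field; rewrite lt0r_neq0.
Qed.

Theorem theorem6 :
  (forall (R : realType) (dT : measure_display) (T : measurableType dT)
     (P : probability T R) (K1 K2 d m : nat) (Sigma : 'M[R]_d) (X : nat -> T -> R),
     (0 < K1)%N -> (0 < K2)%N -> (0 < d)%N -> (0 < m)%N -> K1 = (d * m)%N ->
     covariance_matrix Sigma ->
     (forall k, 0 < Sigma k k) -> 0 < ones_quad Sigma ->
     mutually_independent_vectors P
       (fun (j : 'I_(m * K2)) (k : 'I_d) => X (j * d + k)%N) ->
     (forall j : 'I_(m * K2),
        centered_gaussian_vector P (fun k : 'I_d => X (j * d + k)%N) Sigma) ->
     (\int[P]_w (scaling_stat K1 K2 X w)%:E)%E
     = ((1 / 2) * ((ln (m%:R : R) + ln (ones_quad Sigma)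
                    - (d%:R)^-1 * \sum_(i < d) ln (Sigma i i))
                   / (ln (m%:R : R) + ln (d%:R : R))))%:E)
  /\
  (forall (R : realType) (dT : measure_display) (T : measurableType dT)
     (P : probability T R) (K2 d : nat) (beta : R) (X : nat -> T -> R),
     (2 <= d)%N -> (0 < K2)%N -> 0 <= beta <= 1 ->
     let Sigma : 'M[R]_d :=
       beta *: ((const_mx 1 : 'cV[R]_d) *m (const_mx 1 : 'rV[R]_d))
       + (1 - beta) *: 1%:M in
     mutually_independent_vectors P
       (fun (j : 'I_(1 * K2)) (k : 'I_d) => X (j * d + k)%N) ->
     (forall j : 'I_(1 * K2),
        centered_gaussian_vector P (fun k : 'I_d => X (j * d + k)%N) Sigma) ->
     (\int[P]_w (scaling_stat d K2 X w)%:E)%E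
     = ((1 / 2) * (ln (beta * (d%:R) ^+ 2 + (1 - beta) * d%:R) / ln (d%:R : R)))%:E)
  /\
  (forall (R : realType) (d : nat), (2 <= d)%N ->
     [set (1 / 2) * (ln (beta * (d%:R) ^+ 2 + (1 - beta) * d%:R) / ln (d%:R : R))
       | beta in `[(0 : R), 1]%classic] = `[1 / 2, 1]%classic).

Proof.
split.
  move=> R dT T P K1 K2 d m Sigma X _ K20 d0 m0 K1E _ Skk S1 indX gX.
  exact: (integral_scaling_stat _ _ _ P K1 K2 d m Sigma X).
split; last exact: image_scaling_exponent.
move=> R dT T P K2 d beta X d2 K20 /andP[b0 b1] Sigma indX gX.
have d0 : (0 < d)%N by exact: ltnW.
have dR0 : (0 : R) < d%:R by rewrite ltr0n.
have Skk : forall k, Sigma k k = 1 by exact: equicorrelation_diag.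
have S1 := ones_quad_equicorrelation d beta; rewrite -/Sigma in S1.
have S1_gt0 : 0 < ones_quad Sigma.
  (* In this form the quadratic form is visibly at least d, even in the singular case [beta = 1]. *)
  rewrite S1 (_ : _ + _ = d%:R + beta * (d%:R * (d%:R - 1))); last by ring.
  by rewrite ltr_pwDl// !mulr_ge0 ?subr_ge0 ?ler1n// ltW.
have Skk0 k : 0 < Sigma k k by rewrite Skk.
rewrite (integral_scaling_stat _ _ _ P d K2 d 1 Sigma X K20 d0 _ _ Skk0 S1_gt0 indX gX)//.
  rewrite ln1 !add0r S1 big1 ?mulr0 ?subr0// => k _.
  by rewrite Skk ln1.
by rewrite muln1.
Qed.
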